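(* Let $A$ be a $C^*$-algebra and let $X \subseteq A$ be a subset. Then $X$ generates $A$ as a not necessarily closed ideal if and only if $X \nsubseteq I$ for every prime ideal $I \subseteq A$.
   Context: $C^*$-algebras are not assumed to be unital. An ideal in a $C^*$-algebra means a two-sided ideal that is not necessarily closed. A subset $X$ generates $A$ as a not necessarily closed ideal if the smallest (not necessarily closed) ideal of $A$ containing $X$ is $A$. An ideal $I$ in a ring $R$ is prime if $I \neq R$ and whenever $J, K \subseteq R$ are ideals with $JK \subseteq I$, then $J \subseteq I$ or $K \subseteq I$. Prime ideals are not required to be closed. *)

(* Defs.v *)
From HB Require Import structures.
From mathcomp Require Import all_boot all_order all_algebra.
From mathcomp Require Import complex.
From mathcomp Require Import all_classical all_reals all_analysis.

Set Implicit Arguments.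
Unset Strict Implicit.
Unset Printing Implicit Defensive.

Import Order.TTheory GRing.Theory Num.Theory.
Import numFieldNormedType.Exports.

Local Open Scope classical_set_scope.
Local Open Scope complex_scope.
Local Open Scope ring_scope.

(* The carrier is a complex Banach space; the library norm `|x| takes values in
   the scalar field R[i] and is real and nonnegative there. The product is a
   field of the mixin because the ring structures of the library are unital,
   whereas a C*-algebra need not have a unit. *)
HB.mixin Record isCStarAlgebra (R : realType) A
    of CompleteNormedModule R[i] A := {
  cmul : A -> A -> A;
  star : A -> A;
  cmulA : associative cmul;
  cmulDl : left_distributive cmul +%R;
  cmulDr : right_distributive cmul +%R;
  cmulZl : forall (c : R[i]) (x y : A), cmul (c *: x) y = c *: cmul x y;
  cmulZr : forall (c : R[i]) (x y : A), cmul x (c *: y) = c *: cmul x y;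
  starK : involutive star;
  starD : {morph star : x y / x + y};
  starZ : forall (c : R[i]) (x : A), star (c *: x) = Num.conj c *: star x;
  starM : forall x y : A, star (cmul x y) = cmul (star y) (star x);
  norm_cmul_le : forall x y : A, `|cmul x y| <= `|x| * `|y|;
  norm_star_cmul : forall x : A, `|cmul (star x) x| = `|x| ^+ 2
}.

#[short(type="cstarAlgType")]
HB.structure Definition CStarAlgebra (R : realType) :=
  {A of isCStarAlgebra R A & CompleteNormedModule R[i] A}.

Section Ideals.
Context {R : realType} {A : cstarAlgType R}.
Implicit Types I J K X : set A.

(* Ideals are those of the underlying (possibly non-unital) ring: neither
   closedness in norm nor stability under scalars is required. For prime ideals
   the latter is automatic, see prime_ideal_scale. *)
Definition two_sided_ideal I : Prop :=
  [/\ I 0,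
      forall x y, I x -> I y -> I (x - y),
      forall a x, I x -> I (cmul a x) &
      forall a x, I x -> I (cmul x a)].

Definition ideal_gen X : set A := smallest two_sided_ideal X.

Definition ideal_prod J K : set A :=
  [set x | exists n (a b : 'I_n -> A),
     [/\ forall i, J (a i), forall i, K (b i) & x = \sum_(i < n) cmul (a i) (b i)]].

Definition prime_ideal I : Prop :=
  [/\ two_sided_ideal I,
      I <> [set: A] &
      forall J K, two_sided_ideal J -> two_sided_ideal K ->
        ideal_prod J K `<=` I -> J `<=` I \/ K `<=` I].

Lemma prime_ideal_scale I (c : R[i]) (x : A) :
  prime_ideal I -> I x -> I (c *: x).
Proof.
move=> [[I0 IB IMl IMr] _ Iprime] Ix.
pose J : set A := [set z | forall b, I (cmul z b) /\ I (cmul b z)].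
have J_ideal : two_sided_ideal J.
  have cmul0l b : cmul 0 b = 0 :> A by rewrite -(scale0r (0 : A)) cmulZl !scale0r.
  have cmul0r b : cmul b 0 = 0 :> A by rewrite -(scale0r (0 : A)) cmulZr !scale0r.
  split=> [b|y z Jy Jz b|a z Jz b|a z Jz b].
  - by rewrite cmul0l cmul0r.
  - rewrite -scaleN1r cmulDl cmulDr cmulZl cmulZr !scaleN1r.
    by have [? ?] := Jy b; have [? ?] := Jz b; split; apply: IB.
  - split; first by rewrite -cmulA; apply: IMl; case: (Jz b).
    by rewrite cmulA; case: (Jz (cmul b a)).
  - split; first by rewrite -cmulA; case: (Jz (cmul a b)).
    by rewrite cmulA; apply: IMr; case: (Jz b).
have Jx : J (c *: x).
  move=> b; split; first by rewrite cmulZl -cmulZr; apply: IMr.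
  by rewrite cmulZr -cmulZl; apply: IMl.
have ID y z : I y -> I z -> I (y + z).
  by move=> Iy Iz; rewrite -[z]opprK -[- z]sub0r; apply: (IB _ _ Iy); apply: IB.
have JJI : ideal_prod J J `<=` I.
  move=> _ [n [a [b [Ja _ ->]]]].
  by elim/big_ind : _ => // i _; case: (Ja i (b i)).
by case: (Iprime J J J_ideal J_ideal JJI) => /(_ _ Jx).
Qed.

End Ideals.

(* Main.v *)
(* An ideal not containing a is enlarged by Zorn's lemma to a prime ideal
   avoiding all powers of an element b; this works as soon as the ideal contains
   no power of b, which is guaranteed if a = b^n d_n with d_n in A for every n.

   Such a power factorization exists for every a. For h = (a a^* )^2 the
   resolvents R_m = (1 + m h)^-1 are contractions, [e_m := 1 - R_m] lies in A,
   [|R_m h| <= 2/m], and R_m a tends to 0. They satisfy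
   [(1 - R_m / 2) (1 + R_{2m}) = 1]. Hence for a sparse sequence m_0, m_1, ...
   the product of the (1 - R_{m_j} / 2) has the explicit inverse
   [prod_j (1 + R_{2 m_j})], whose powers converge on a if R_{2 m_j} a is small
   enough, while the former product converges to an element b of A: its scalar
   part 2^-J tends to 0. *)
From HB Require Import structures.
Require Import Defs.
From mathcomp Require Import all_boot all_order all_algebra.
From mathcomp Require Import complex.
From mathcomp Require Import all_classical all_reals all_analysis.
From mathcomp Require Import ring lra zify.

Set Implicit Arguments.
Unset Strict Implicit.
Unset Printing Implicit Defensive.

Import Order.TTheory GRing.Theory Num.Theory.
Import numFieldNormedType.Exports.

Local Open Scope classical_set_scope.
Local Open Scope complex_scope.
Local Open Scope ring_scope.

Local Infix "**" := cmul (at level 40, left associativity).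

(* The square-zero extension of the integers by [V]: it turns an identity
   between integer combinations in [V] into one that [ring] decides. *)
Definition sqz (V : zmodType) := (int * V)%type.

Section SquareZero.
Variable V : zmodType.

HB.instance Definition _ := GRing.Zmodule.on (sqz V).

Let one : sqz V := (1, 0).
Let mul (u v : sqz V) : sqz V := (u.1 * v.1, v.2 *~ u.1 + u.2 *~ v.1).

Fact sqz_mulA : associative mul.
Proof.
move=> [a u] [b v] [c w]; rewrite /mul /=; rewrite mulrA; congr pair.

rewrite !mulrzDl (mulrC a b) !mulrzA -addrA.
by rewrite (mulrzAC a c v).
Qed.

Fact sqz_mulC : commutative mul.
Proof. by move=> [a u] [b v]; rewrite /mul /= addrC; congr (_, _); exact: mulrC. Qed.

Fact sqz_mul1 : left_id one mul.
Proof.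
move=> [a u]; rewrite /mul /= mulr1z mul0rz addr0.
by congr (_, _); exact: mul1r.
Qed.

Fact sqz_mulDl : left_distributive mul +%R.
Proof.
move=> [a u] [b v] [c w]; rewrite /mul /=; congr (_, _).
  exact: mulrDl.
by rewrite mulrzDl mulrzDr addrACA.
Qed.

Fact sqz_oner_neq0 : one != 0.
Proof. by []. Qed.

HB.instance Definition _ := GRing.Zmodule_isComNzRing.Build (sqz V)
  sqz_mulA sqz_mulC sqz_mul1 sqz_mulDl sqz_oner_neq0.

Definition to_sqz (v : V) : sqz V := (0, v).

Lemma to_sqz_inj : injective to_sqz. Proof. by move=> u v []. Qed.
Lemma to_sqz0 : to_sqz 0 = 0. Proof. by []. Qed.
Lemma to_sqzD u v : to_sqz (u + v) = to_sqz u + to_sqz v. Proof. by []. Qed.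
Lemma to_sqzN u : to_sqz (- u) = - to_sqz u. Proof. by []. Qed.
Lemma to_sqzMn u n : to_sqz (u *+ n) = to_sqz u *+ n.
Proof. by elim: n => // n IHn; rewrite !mulrS to_sqzD IHn. Qed.

End SquareZero.

Ltac zmod := apply: to_sqz_inj; rewrite ?(to_sqzD, to_sqzN, to_sqzMn, to_sqz0); ring.

(** * Real-valued norm, completeness and fixed points *)

Section Basics.
Context {R : realType} {A : cstarAlgType R}.
Implicit Types x y z : A.

Lemma cmul0l x : 0 ** x = 0.
Proof. by rewrite -(scale0r (0 : A)) cmulZl !scale0r. Qed.

Lemma cmul0r x : x ** 0 = 0.
Proof. by rewrite -(scale0r (0 : A)) cmulZr !scale0r. Qed.

Lemma cmulNl x y : (- x) ** y = - (x ** y).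
Proof. by rewrite -scaleN1r cmulZl scaleN1r. Qed.

Lemma cmulNr x y : x ** (- y) = - (x ** y).
Proof. by rewrite -scaleN1r cmulZr scaleN1r. Qed.

Lemma cmulBl x y z : (x - y) ** z = x ** z - y ** z.
Proof. by rewrite cmulDl cmulNl. Qed.

Lemma cmulBr x y z : x ** (y - z) = x ** y - x ** z.
Proof. by rewrite cmulDr cmulNr. Qed.

Lemma star0 : star 0 = 0 :> A.
Proof. by rewrite -(scale0r (0 : A)) starZ conjC0 !scale0r. Qed.

Lemma starN x : star (- x) = - star x.
Proof. by apply/eqP; rewrite -addr_eq0 -starD addNr star0. Qed.

Lemma starB x y : star (x - y) = star x - star y.
Proof. by rewrite starD starN. Qed.

(** The given norm lies in [R[i]], whose order is only partial; the real version permits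
    ordered-field arithmetic. *)
Definition nrm x : R := complex.Re `|x|.

Lemma nrmE x : `|x| = (nrm x)%:C.
Proof. by rewrite /nrm RRe_real // normr_real. Qed.

Lemma nrm_ge0 x : 0 <= nrm x.
Proof. by rewrite -ler0c -nrmE. Qed.

Lemma nrm0_eq0 x : nrm x = 0 -> x = 0.
Proof. by move=> x0; apply/normr0_eq0; rewrite nrmE x0. Qed.

Lemma nrm0 : nrm 0 = 0.
Proof. by rewrite /nrm normr0. Qed.

Lemma nrmN x : nrm (- x) = nrm x.
Proof. by rewrite /nrm normrN. Qed.

Lemma nrmC x y : nrm (x - y) = nrm (y - x).
Proof. by rewrite -nrmN opprB. Qed.

Lemma ler_nrmD x y : nrm (x + y) <= nrm x + nrm y.
Proof. by rewrite -lecR rmorphD /= -!nrmE ler_normD. Qed.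

Lemma ler_nrmB x y : nrm (x - y) <= nrm x + nrm y.
Proof. by rewrite -(nrmN y) ler_nrmD. Qed.

Lemma ler_nrm_dist x y z : nrm (x - z) <= nrm (x - y) + nrm (y - z).
Proof. by rewrite (le_trans _ (ler_nrmD _ _)) // addrA subrK. Qed.

Lemma nrmZ (c : R) x : nrm (c%:C *: x) = `|c| * nrm x.
Proof.
apply: complexI; rewrite rmorphM /= -!nrmE normrZ; congr (_ * _).
by rewrite normc_def /= expr0n addr0 sqrtr_sqr.
Qed.

Lemma nrmMn x n : nrm (x *+ n) = nrm x *+ n.
Proof.
by rewrite -scaler_nat -(rmorph_nat (real_complex R)) nrmZ normr_nat mulr_natl.
Qed.

Lemma ler_nrmM x y : nrm (x ** y) <= nrm x * nrm y.
Proof. by rewrite -lecR rmorphM /= -!nrmE norm_cmul_le. Qed.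

Lemma nrm_starM x : nrm (star x ** x) = nrm x ^+ 2.
Proof. by apply: complexI; rewrite rmorphXn /= -!nrmE norm_star_cmul. Qed.

(** The C*-identity gives [nrm y ^+ 2 <= nrm (star y) * nrm y]; cancel [nrm y], then use the
    involution for the converse. *)
Lemma nrm_star x : nrm (star x) = nrm x.
Proof.
have le_star y : nrm y <= nrm (star y).
  have := nrm_starM y; have := ler_nrmM (star y) y; have := nrm_ge0 y.
  rewrite le_eqVlt => /predU1P[<- _ _|y0 + e]; first exact: nrm_ge0.
  by rewrite e expr2 ler_pM2r.
by apply/eqP; rewrite eq_le le_star -{2}[x]starK le_star.
Qed.

Lemma cvg_half (C : R) : (fun n : nat => C * 2^-1 ^+ n) @ \oo --> (0 : R).
Proof. by apply: cvg_geometric; rewrite ger0_norm // invf_lt1 // ltr1n. Qed.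

Lemma nrm_geometric_cvg (u : nat -> A) (C : R) J0 :
  (forall J, (J0 <= J)%N -> nrm (u J.+1 - u J) <= C * 2^-1 ^+ J) ->
  exists l, forall J, (J0 <= J)%N -> nrm (l - u J) <= 2 * C * 2^-1 ^+ J.
Proof.
move=> du.
(* Keeping the subtracted tail lets the induction on [p] close. *)
have tele J p : (J0 <= J)%N ->
    nrm (u (J + p)%N - u J) <= 2 * C * 2^-1 ^+ J - 2 * C * 2^-1 ^+ (J + p).
  move=> J0J; elim: p => [|p IHp]; first by rewrite addn0 !subrr nrm0.
  apply: (le_trans (ler_nrm_dist _ (u (J + p)%N) _)).
  rewrite addnS; have := du (J + p)%N; rewrite (leq_trans J0J (leq_addr _ _)).
  move: IHp => /[swap] /(_ isT); rewrite exprS; set t := 2^-1 ^+ (J + p); lra.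
have C0 : 0 <= C.
  have := le_trans (nrm_ge0 _) (du J0 (leqnn _)).
  by rewrite pmulr_lge0 // exprn_gt0.
have tele' J n : (J0 <= J)%N -> (J <= n)%N ->
    nrm (u n - u J) <= 2 * C * 2^-1 ^+ J.
  move=> J0J /subnKC <-; apply: (le_trans (tele _ _ J0J)).
  by rewrite gerBl // !mulr_ge0 // exprn_ge0.
have small (e : R) : 0 < e -> exists2 J, (J0 <= J)%N & 2 * C * 2^-1 ^+ J < e.
  move=> e0; have /cvgrPdist_lt/(_ _ e0)[N _ HN] := cvg_half (2 * C).
  exists (maxn J0 N); first exact: leq_maxl.
  have := HN (maxn J0 N) (leq_maxr _ _).
  by rewrite sub0r normrN => /(le_lt_trans (ler_norm _)).
have uc : cvg (u @ \oo).
  apply: cauchy_cvg; apply: cauchy_exP => e e0.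
  have /andP[/eqP ie re0] : (complex.Im e == 0) && (0 < complex.Re e).
    by move: e0; rewrite ltcE.
  have [J J0J HJ] := small _ re0; exists (u J); exists J => // n /= Jn.
  rewrite -ball_normE /= -normrN opprB nrmE ltcE /= ie eqxx /=.
  exact: le_lt_trans (tele' _ _ J0J Jn) HJ.
exists (lim (u @ \oo)) => J J0J.
apply/ler_addgt0Pr => e e0.
have /cvgrPdist_lt/(_ e%:C) : u @ \oo --> lim (u @ \oo) by [].
rewrite ltcR => /(_ e0)[N _ HN].
have := HN (maxn J N) (leq_maxr _ _); rewrite /= nrmE ltcR => lN.
apply: (le_trans (ler_nrm_dist _ (u (maxn J N)) _)).
by rewrite addrC lerD // ?(ltW lN)// tele' // leq_maxl.
Qed.

Lemma nrm_geometric_eq0 x (C : R) J0 :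
  (forall J, (J0 <= J)%N -> nrm x <= C * 2^-1 ^+ J) -> x = 0.
Proof.
move=> Hx; apply: nrm0_eq0; apply/eqP; rewrite eq_le nrm_ge0 andbT.
apply: (ler_cvg_to (cvg_cst (nrm x)) (cvg_half C)).
by exists J0 => // n /= /Hx.
Qed.

(** Banach's fixed point theorem, used below to solve linear equations in place of Neumann
    series. *)
Lemma half_contraction_fix (f : A -> A) :
  (forall x y, nrm (f x - f y) <= 2^-1 * nrm (x - y)) -> exists x, f x = x.
Proof.
move=> fc; pose u n := iter n f 0.
have du J : nrm (u J.+1 - u J) <= nrm (u 1 - u 0) * 2^-1 ^+ J.
  elim: J => [|J IHJ]; first by rewrite mulr1.
  by rewrite (le_trans (fc _ _)) // exprS mulrCA ler_pM2l.
have [l Hl] := nrm_geometric_cvg (J0 := 0) (fun J _ => du J).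
exists l; apply/eqP; rewrite -subr_eq0; apply/eqP.
apply: (@nrm_geometric_eq0 _ (2 * nrm (u 1%N - u 0%N)) 0) => J _.
apply: (le_trans (ler_nrm_dist _ (u J.+1) _)).
have := fc l (u J); have := Hl J isT; have := Hl J.+1 isT.
rewrite [nrm (u _ - l)]nrmC exprS -[f (u J)]/(u J.+1); set t := _ ^+ _; lra.
Qed.

End Basics.

(** * Quasi-inverses by norm estimates *)

Section QuasiInverse.
Context {R : realType} {A : cstarAlgType R}.
Implicit Types a e h k x y z : A.

(** By the C*-identity it suffices to compare [star w ** w] for both vectors [w]: the terms linear
    in [c] cancel and only [c * c] survives. *)
Lemma nrm_skew_perturb (c : R[i]) k z : star k = k -> Num.conj c = - c ->
  nrm (z + c *: (k ** z)) = nrm (z - c *: (k ** z)).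
Proof.
have skew (d : R[i]) : star k = k -> Num.conj d = - d ->
    star (z + d *: (k ** z)) ** (z + d *: (k ** z)) =
    star z ** z - (d * d) *: (star z ** (k ** (k ** z))).
  move=> sk sd; rewrite starD starZ starM sk sd !(cmulDl, cmulDr).
  rewrite !(cmulZl, cmulZr) !scalerA !scaleNr -!cmulA.
  by rewrite addrA addrK mulNr scaleNr.
move=> sk sc; apply: (@pexpIrn _ 2) => //; rewrite ?nnegrE ?nrm_ge0 //.
rewrite -!nrm_starM -scaleNr !skew // ?mulrNN //.
by rewrite rmorphN /= sc.
Qed.

(* [1 + k^2 = (1 + ik)(1 - ik)], and [1 + ik] and [1 - ik] are equally large in
   norm on each vector, so [(1 + ik)^2] and [(1 - ik)^2] are both dominated by
   [1 + k^2], as is their combination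
   [4 = 2 (1 + k^2) + (1 + ik)^2 + (1 - ik)^2]. *)
Lemma nrm_le_add_sqr k z : star k = k -> nrm z <= nrm (z + k ** k ** z).
Proof.
move=> sk; pose J (c : R[i]) y := y + c *: (k ** y).
have JJ c d y : J c (J d y) = y + (c + d) *: (k ** y) + (c * d) *: (k ** k ** y).
  by rewrite /J cmulDr cmulZr scalerDr scalerA cmulA scalerDl; zmod.
have Jiso y : nrm (J 'i y) = nrm (J (- 'i) y).
  by rewrite /J scaleNr; apply: nrm_skew_perturb => //; exact: conjCi.
have ii : 'i * 'i = -1 :> R[i] by rewrite -expr2 sqrCi.
have JpJm y : J 'i (J (- 'i) y) = y + k ** k ** y.
  by rewrite JJ subrr scale0r addr0 mulrN ii opprK scale1r.
have JmJp y : J (- 'i) (J 'i y) = y + k ** k ** y.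
  by rewrite JJ addNr scale0r addr0 mulNr ii opprK scale1r.
have e4 : z *+ 4 = (z + k ** k ** z) *+ 2 + J 'i (J 'i z) + J (- 'i) (J (- 'i) z).
  by rewrite !JJ mulrNN ii scaleN1r -opprD scaleNr; zmod.
have := ler_nrmD ((z + k ** k ** z) *+ 2 + J 'i (J 'i z)) (J (- 'i) (J (- 'i) z)).
have := ler_nrmD ((z + k ** k ** z) *+ 2) (J 'i (J 'i z)).
rewrite -e4 !nrmMn Jiso JmJp -Jiso JpJm; lra.
Qed.

(** Being bounded below by 1 is a property of [1 + h] that replaces positivity of [h] and needs no
    spectral theory. *)
Definition expansive h := star h = h /\ forall z, nrm z <= nrm (z + h ** z).

Lemma expansive_inj h x y : expansive h -> x + h ** x = y + h ** y -> x = y.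
Proof.
move=> [_ hE] e; apply/eqP; rewrite -subr_eq0; apply/eqP/nrm0_eq0/eqP.
rewrite eq_le nrm_ge0 andbT (le_trans (hE _)) // cmulBr addrACA e.
by rewrite -opprD subrr nrm0.
Qed.

(* [e = h (1 + h)^-1], so that [x - e ** x] is [(1 + h)^-1 x]. *)
Definition quasi h e := expansive h /\ e + h ** e = h.

Section Quasi.
Variables h e : A.
Hypothesis he : quasi h e.

Let star_quasi : star e + star e ** h = h.
Proof. by have [[sh _] E] := he; rewrite -[in RHS]sh -[in RHS]E starD starM sh. Qed.

(** Both sides equal [(star e + star e ** h) ** e]. *)
Let star_quasiC : star e ** h = h ** e.
Proof.
by have [_ E] := he; rewrite -[in LHS]E cmulDr cmulA -cmulDl star_quasi.
Qed.

Lemma quasi_star : star e = e.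
Proof.
have [_ E] := he.
by apply: (addIr (h ** e)); rewrite E -star_quasiC star_quasi.
Qed.

Lemma quasiC : e ** h = h ** e.
Proof. by rewrite -{1}quasi_star star_quasiC. Qed.

Lemma quasi_res x : h ** (x - e ** x) = e ** x.
Proof.
have [_ E] := he.
by rewrite cmulBr cmulA -{1}E cmulDl addrK.
Qed.

Lemma nrm_quasi_res x : nrm (x - e ** x) <= nrm x.
Proof.
have [[_ hE] _] := he.
by rewrite (le_trans (hE _)) // quasi_res subrK.
Qed.

Lemma nrm_quasi_mul x : nrm (e ** x) <= 2 * nrm x.
Proof.
have := ler_nrm_dist (e ** x) x 0; rewrite !subr0 [nrm (_ - x)]nrmC.
by have := nrm_quasi_res x; lra.
Qed.

(** The bound on left multiplication, taken at [e] itself, bounds [nrm e ^+ 2] by the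
    C*-identity. *)
Lemma nrm_quasi : nrm e <= 2.
Proof.
have := nrm_starM e; rewrite quasi_star; have := nrm_quasi_mul e.
have := nrm_ge0 e; rewrite le_eqVlt => /predU1P[<- //|e0 + ee].
by rewrite ee expr2 ler_pM2r.
Qed.

(** Both products solve [x + h ** x = h ** y]. *)
Lemma quasi_commute y : y ** h = h ** y -> y ** e = e ** y.
Proof.
have [hE E] := he => yh; apply: (expansive_inj hE).
by rewrite [in RHS]cmulA -cmulDl E [in LHS]cmulA -yh -cmulA -cmulDr E.
Qed.

(** Since [1 + e = (1 + 2h)(1 + h)^-1], the element [e' = 2h (1 + 2h)^-1] solves [(1 + e) e' = 2e].
    This equation is [(1 - R_m / 2)(1 + R_{2m}) = 1] rewritten. *)
Lemma quasi_double : exists e',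
  quasi (h + h) e' /\ e' + e ** e' = e + e.
Proof.
have [[sh hE] E] := he.
(* Fixed points of [f] solve [(1 + e) x = 2e]. *)
pose f x := e + (2^-1)%:C *: (x - e ** x).
have [e' fe'] : exists x, f x = x.
  apply: half_contraction_fix => x y.
  have -> : f x - f y = (2^-1)%:C *: ((x - y) - e ** (x - y)).
    by rewrite /f !(cmulBr, scalerBr); zmod.
  by rewrite nrmZ ger0_norm // ler_pM2l // nrm_quasi_res.
have E' : e' + e ** e' = e + e.
  have fB : f e' - e = (2^-1)%:C *: (e' - e ** e') by rewrite /f; zmod.
  have : (f e' - e) + (f e' - e) = (e' - e) + (e' - e) by rewrite fe'.
  have half2 : (2^-1 : R) + 2^-1 = 1 by field.
  rewrite {}fB -scalerDl -rmorphD /= half2 scale1r => H.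
  have -> : e' + e ** e' = e' + e' - (e' - e ** e') by zmod.
  by rewrite H; zmod.
exists e'; split=> //; split; first split.
- by rewrite starD sh.
- move=> z.
  (* Here [1 + 2h = (1 + h)(1 + e)], and [1 + e] is bounded below by 1 because
     [2z = (1 + e)z + (1 - e)z] with [1 - e] contractive. *)
  have -> : z + (h + h) ** z = (z + e ** z) + h ** (z + e ** z).
    have /eqP := quasi_res z; rewrite cmulBr subr_eq => /eqP hz.
    by rewrite !(cmulDl, cmulDr) hz; zmod.
  rewrite (le_trans _ (hE _)) //.
  have := ler_nrmD (z + e ** z) (z - e ** z).
  have -> : z + e ** z + (z - e ** z) = z *+ 2 by zmod.
  by rewrite nrmMn; have := nrm_quasi_res z; lra.
- have /eqP := quasi_res e'; rewrite cmulBr subr_eq => /eqP he'.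
  have hE' : h ** e' + h ** (e ** e') = h ** e + h ** e by rewrite -!cmulDr E'.
  transitivity (e' + e ** e' + (h ** e' + h ** (e ** e'))).
    by rewrite cmulDl he'; zmod.
  by rewrite hE' E' addrACA E.
Qed.

End Quasi.
End QuasiInverse.

(** * An approximate unit built by repeated doubling *)

Section PowerFactorization.
Context {R : realType} {A : cstarAlgType R}.
Implicit Types a e h k x y z : A.

Lemma cmulMnl x y n : (x *+ n) ** y = (x ** y) *+ n.
Proof. by elim: n => [|n IHn]; rewrite ?cmul0l // !mulrS cmulDl IHn. Qed.

Lemma cmulMnr x y n : x ** (y *+ n) = (x ** y) *+ n.
Proof. by elim: n => [|n IHn]; rewrite ?cmul0r // !mulrS cmulDr IHn. Qed.

Lemma quasi_exists h : expansive h -> nrm h <= 2^-1 -> exists e, quasi h e.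
Proof.
move=> hE h2; have [e he] : exists e, h - h ** e = e.
  apply: half_contraction_fix => x y.
  have -> : h - h ** x - (h - h ** y) = - (h ** (x - y)) by rewrite cmulBr; zmod.
  by rewrite nrmN (le_trans (ler_nrmM _ _)) // ler_wpM2r // nrm_ge0.
by exists e; split=> //; rewrite -{1}he subrK.
Qed.

Lemma quasi_seq h : expansive h -> nrm h <= 2^-1 ->
  exists e : nat -> A, forall n,
    quasi (h *+ 2 ^ n) (e n) /\ e n.+1 + e n ** e n.+1 = e n + e n.
Proof.
move=> hE h2.
have hS n : h *+ 2 ^ n.+1 = h *+ 2 ^ n + h *+ 2 ^ n by rewrite expnS mul2n -addnn mulrnDr.
have /choice[e he] : forall n, exists e, quasi (h *+ 2 ^ n) e.
  elim=> [|n [e he]]; first exact: quasi_exists.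
  by have [e' []] := quasi_double he; rewrite -hS; exists e'.
exists e => n; split=> //.
(* The elements were chosen independently for each [n]; uniqueness of the quasi-inverse restores the
   doubling identity. *)
have [e' []] := quasi_double (he n); rewrite -hS => he' <-.
suff -> : e n.+1 = e' by [].
by apply: (expansive_inj he'.1); rewrite he'.2 (he n.+1).2.
Qed.

(** For [y = x - e ** x], the product [y ** star y] is [u (1 - e)] with [u] as on the right; the
    factor 3 bounds [1 - e]. *)
Lemma nrm_sub_sqr e x : star e = e -> nrm e <= 2 ->
  nrm (x - e ** x) ^+ 2 <= 3 * nrm (x ** star x - e ** (x ** star x)).
Proof.
move=> se e2; rewrite -[X in X ^+ 2]nrm_star -nrm_starM starK starB starM se.
set u := x ** star x - _.
have -> : (x - e ** x) ** (star x - star x ** e) = u - u ** e.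
  by rewrite /u !(cmulBl, cmulBr) !cmulA; zmod.
have := ler_nrmB u (u ** e); have := ler_nrmM u e.
have := ler_wpM2l (nrm_ge0 u) e2; lra.
Qed.

Lemma approximate_unit a : nrm a <= 2^-1 ->
  exists e : nat -> A, forall n,
  [/\ forall m, e m ** e n = e n ** e m,
      e n.+1 + e n ** e n.+1 = e n + e n,
      forall x, nrm (x - e n ** x) <= nrm x,
      nrm (e n) <= 2 &
      (forall m, nrm (e m - e n ** e m) * 2 ^+ n <= 2 * 2 ^+ m)
      /\ nrm (a - e n ** a) ^+ 4 * 2 ^+ n <= 54].
Proof.
move=> a2; pose k := a ** star a; pose h := k ** k.
have sk : star k = k by rewrite /k starM starK.
have sh : star h = h by rewrite /h starM sk.
have hE : expansive h by split=> // z; exact: nrm_le_add_sqr.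
have k2 : nrm k <= 2^-1.
  have := ler_nrmM a (star a); rewrite nrm_star.
  by have := nrm_ge0 a; move: a2; rewrite -/k; nra.
have h2 : nrm h <= 2^-1.
  by have := ler_nrmM k k; have := nrm_ge0 k; move: k2; rewrite -/h; nra.
have [e he] := quasi_seq hE h2.
have qe n := (he n).1.
have hn n : h *+ 2 ^ n - e n ** h *+ 2 ^ n = e n.
  by rewrite -cmulMnr (quasiC (qe n)) -{1}(qe n).2 addrK.
have eC m n : e m ** e n = e n ** e m.
  apply: (quasi_commute (qe n)).
  by rewrite cmulMnl cmulMnr; congr (_ *+ _); apply/esym/(quasi_commute (qe m));
    rewrite cmulMnl cmulMnr.
exists e => n; split=> //.
- exact: (he n).2.
- exact: nrm_quasi_res (qe n).
- exact: nrm_quasi (qe n).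
have en2 := nrm_quasi (qe n); have sen := quasi_star (qe n); split.
  move=> m.
  (* Both sides are the norm of [2^(m+n) h (1 - e m)(1 - e n)]. *)
  have -> : nrm (e m - e n ** e m) * 2 ^+ n = nrm (e n - e m ** e n) * 2 ^+ m.
    rewrite -!natrX !mulr_natr -!nrmMn; congr nrm.
    have eh j i : e i - e j ** e i = (h - e i ** h - e j ** (h - e i ** h)) *+ 2 ^ i.
      by rewrite -{1 2}(hn i) -mulrnBl cmulMnr -mulrnBl.
    rewrite !eh mulrnAC; congr (_ *+ _ *+ _).
    by rewrite !cmulBr !cmulA (eC m n); zmod.
  rewrite ler_wpM2r ?exprn_ge0 //.
  exact: le_trans (nrm_quasi_res (qe m) _) en2.
have hn2 : nrm (h - e n ** h) * 2 ^+ n <= 2.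
  by rewrite -natrX mulr_natr -nrmMn mulrnBl hn.
have := nrm_sub_sqr a sen en2; have := nrm_sub_sqr k sen en2.
rewrite -/k sk -/h => H1 H2.
have n0 : 0 < 2 ^+ n :> R by rewrite exprn_gt0.
(* Passing from [a] to [k] and from [k] to [h] gives the fourth power and the constant
   [27 = 3^2 * 3]. *)
apply: (@le_trans _ _ (27 * (nrm (h - e n ** h) * 2 ^+ n))); last lra.
rewrite mulrA ler_pM2r // (exprM _ 2 2).
have := nrm_ge0 (k - e n ** k).
move: H1 H2; have := sqr_ge0 (nrm (a - e n ** a)).
set p := _ ^+ 2; set q := nrm (k - _); nra.
Qed.

End PowerFactorization.

(** * Convergence of the products along a sparse sequence *)

Section SlowProducts.
Context {R : realType} {A : cstarAlgType R}.
Implicit Types x y z : A.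
Variables (a : A) (e : nat -> A).
Hypothesis eC : forall m n, e m ** e n = e n ** e m.
Hypothesis e_double : forall n, e n.+1 + e n ** e n.+1 = e n + e n.
Hypothesis e_contr : forall n x, nrm (x - e n ** x) <= nrm x.
Hypothesis e_le2 : forall n, nrm (e n) <= 2.
Hypothesis e_approx :
  forall n m, nrm (e m - e n ** e m) * 2 ^+ n <= 2 * 2 ^+ m.
Hypothesis e_approx_a : forall n, nrm (a - e n ** a) ^+ 4 * 2 ^+ n <= 54.

(** With [m_J = 2^(4 J^2)], [f J] is [1 - R_{m_J}] and [g J] is [1 - R_{2 m_J}]. The 4 offsets the
    fourth power in [e_approx_a]; the square beats exponents linear in [J]. *)
Let f J := e (4 * J ^ 2).
Let g J := e (4 * J ^ 2).+1.

(* [2^-J *: slow_prod J] is the product of the [1 - R_{m_j} / 2] over [j < J], with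
   [m_j = 2^(4 j^2)], minus its scalar part [2^-J]. *)
Fixpoint slow_prod J : A :=
  if J is J'.+1 then slow_prod J' + f J' ** slow_prod J' + f J' else 0.

(** The product of the [1 + R_{2 m_j} = 2 - g j] over [j < J], as an operator because there is no
    unit. *)
Fixpoint slow_inv J x : A :=
  if J is J'.+1 then slow_inv J' x + (slow_inv J' x - g J' ** slow_inv J' x)
  else x.

(** As [J] grows this tends to the factor [d N]. *)
Let c N J := iter N (slow_inv J) a.

Lemma slow_invB J x y : slow_inv J (x - y) = slow_inv J x - slow_inv J y.
Proof. by elim: J => //= J ->; rewrite cmulBr; zmod. Qed.

Lemma slow_invC J n x : e n ** slow_inv J x = slow_inv J (e n ** x).
Proof.
elim: J => //= J IHJ.
by rewrite cmulDr cmulBr [e n ** (_ ** _)]cmulA eC -cmulA IHJ.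
Qed.

Lemma nrm_slow_inv J x : nrm (slow_inv J x) <= 2 ^+ J * nrm x.
Proof.
elim: J => [|J IHJ] /=; first by rewrite mul1r.
apply: (le_trans (ler_nrmD _ _)); have := e_contr (4 * J ^ 2).+1 (slow_inv J x).
by rewrite exprS; move: IHJ; rewrite -/(g J); set t := 2 ^+ J; lra.
Qed.

Lemma slow_prodC J n : e n ** slow_prod J = slow_prod J ** e n.
Proof.
elim: J => [|J IHJ] /=; first by rewrite cmul0l cmul0r.
by rewrite !(cmulDl, cmulDr) IHJ cmulA [e n ** f J]eC -!cmulA IHJ.
Qed.

(** [1 + slow_prod J] is the product of the [1 + f j], and [(1 + f j)(2 - g j) = 2]. *)
Lemma slow_prodK J x : slow_inv J x + slow_prod J ** slow_inv J x = x *+ 2 ^ J.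
Proof.
elim: J => [|J IHJ] /=; first by rewrite cmul0l addr0.
rewrite expnS mul2n -addnn mulrnDr -IHJ.
set y := slow_inv J x; set p := slow_prod J; set F := f J; set G := g J.
have GE z : G ** z + F ** G ** z = F ** z + F ** z.
  by rewrite -!cmulDl e_double.
have pG z : p ** (G ** z) = G ** (p ** z).
  have Gp : G ** p = p ** G by exact: slow_prodC.
  by rewrite !cmulA Gp.
set w := y + p ** y.
transitivity ((w + w + (F ** w + F ** w)) - (G ** w + F ** G ** w)).
  by rewrite /w !(cmulDl, cmulDr, cmulBr) -!cmulA !pG; zmod.
by rewrite GE addrK.
Qed.

(** At [n = 4 * J ^ 2] this bounds [slow_prod J - f J ** slow_prod J] by 1, as the convergence of
    the scaled products requires. *)
Lemma nrm_slow_prod_approx J n :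
  nrm (slow_prod J - e n ** slow_prod J) * 2 ^+ n <= 2 ^+ (4 * J ^ 2).
Proof.
elim: J n => [|J IHJ] n /=.
  by rewrite cmul0r subrr nrm0 mul0r exprn_ge0.
set q := slow_prod J - e n ** slow_prod J; set r := f J - e n ** f J.
have -> : slow_prod J + f J ** slow_prod J + f J -
    e n ** (slow_prod J + f J ** slow_prod J + f J) =
    q + f J ** q + r.
  by rewrite /q /r !(cmulDr, cmulBr) [e n ** (f J ** _)]cmulA eC -cmulA; zmod.
have -> : (4 * J.+1 ^ 2 = 4 * J ^ 2 + (8 * J + 4))%N by ring.
(* The recursion costs [3 + 2 = 5] times the old bound; the larger exponent supplies at least 16. *)
have H : 5 <= 2 ^+ (8 * J + 4) :> R.
  by rewrite -natrX ler_nat addnC expnD (leq_trans (n := 16)) // leq_pmulr ?expn_gt0.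
have H1 := IHJ n; have H2 := e_approx n (4 * J ^ 2).
have H3 := ler_nrmD (q + f J ** q) r; have H4 := ler_nrmD q (f J ** q).
have H5 := ler_nrmM (f J) q.
have H6 := ler_wpM2r (nrm_ge0 q) (e_le2 (4 * J ^ 2)).
rewrite exprD; move: H1 H2; rewrite -/(f J) -/q -/r.
have n0 : 0 < 2 ^+ n :> R by rewrite exprn_gt0.
have : 0 < 2 ^+ (4 * J ^ 2) :> R by rewrite exprn_gt0.
set M := 2 ^+ (4 * _)%N; set t := 2 ^+ n in n0 *; set s := 2 ^+ _ in H *.
move=> M0 H1 H2; apply: (@le_trans _ _ (5 * M)); last by rewrite mulrC ler_pM2l.
apply: (@le_trans _ _ ((3 * nrm q + nrm r) * t)); last by lra.
rewrite ler_pM2r //; move: H6; rewrite -/(f J); lra.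
Qed.

(** Consecutive scaled terms differ by [2^-(J+1) (f J - (1 - f J) slow_prod J)], whose bracket has
    norm at most 3. *)
Lemma slow_limit : exists b, forall J,
  nrm (b - (2^-1 ^+ J)%:C *: slow_prod J) <= 4 * 2^-1 ^+ J.
Proof.
pose u J := (2^-1 ^+ J)%:C *: slow_prod J.
have du J : (0 <= J)%N -> nrm (u J.+1 - u J) <= 2 * 2^-1 ^+ J.
  move=> _.
  have -> : u J.+1 - u J =
      (2^-1 ^+ J.+1)%:C *: (f J - (slow_prod J - f J ** slow_prod J)).
    have -> : u J = (2^-1 ^+ J.+1)%:C *: (slow_prod J + slow_prod J).
      by rewrite /u scalerDr -scalerDl -rmorphD; congr (_%:C *: _); rewrite exprS; field.
    by rewrite /u -scalerBr /=; congr (_ *: _); zmod.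
  rewrite nrmZ ger0_norm ?exprn_ge0 // exprS.
  have h0 : 0 <= 2^-1 ^+ J :> R by rewrite exprn_ge0.
  have := ler_nrmB (f J) (slow_prod J - f J ** slow_prod J).
  have := e_le2 (4 * J ^ 2); have := nrm_slow_prod_approx J (4 * J ^ 2).
  rewrite -[leRHS]mul1r ler_pM2r ?exprn_gt0 // -/(f J) => H1 H2 H3.
  have {H1 H2 H3} := le_trans H3 (lerD H2 H1).
  by move: h0; set t := _ ^+ J; nra.
have [b Hb] := nrm_geometric_cvg du; exists b => J.
by have := Hb J isT; rewrite -natrM.
Qed.

(** Compare fourth powers, using [54 / 2 <= 3^4]. *)
Lemma nrm_a_approx J : nrm (a - g J ** a) <= 3 * 2^-1 ^+ (J ^ 2).
Proof.
have := e_approx_a (4 * J ^ 2).+1; rewrite -/(g J) [2 ^+ _.+1]exprS (mulnC 4) exprM.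
set d := nrm _; set t := 2 ^+ (J ^ 2) => H.
have t0 : 0 < t by rewrite exprn_gt0.
rewrite exprVn -/t -ler_pdivrMr ?invr_gt0 // invrK.
rewrite -(@ler_pXn2r _ 4) ?nnegrE ?mulr_ge0 ?nrm_ge0 ?ltW // exprMn.
by move: H; rewrite mulrCA; lra.
Qed.

(** Induction on [N]: the new factor [1 + (1 - g J)] leaves [slow_inv J.+1] of the previous
    difference plus a term where [1 - g J] commutes through to act on [a]. *)
Lemma nrm_slow_iter_step N J :
  nrm (c N J.+1 - c N J) <= N%:R * 2 ^+ (J.+1 * N.+1) * nrm (a - g J ** a).
Proof.
have itL M : c M J - g J ** c M J = iter M (slow_inv J) (a - g J ** a).
  elim: M => //= M <-; by rewrite slow_invB slow_invC.
have ncg M : nrm (c M J - g J ** c M J) <= 2 ^+ (J * M) * nrm (a - g J ** a).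
  rewrite itL; elim: M => [|M IHM] /=; first by rewrite muln0 mul1r.
  rewrite (le_trans (nrm_slow_inv _ _)) // mulnS exprD -mulrA ler_pM2l ?exprn_gt0 //.
elim: N => [|N IHN]; first by rewrite subrr nrm0 !mul0r.
have -> : c N.+1 J.+1 - c N.+1 J =
    slow_inv J.+1 (c N J.+1 - c N J) + (c N.+1 J - g J ** c N.+1 J).
  by rewrite slow_invB /=; zmod.
apply: (le_trans (ler_nrmD _ _)).
have H1 := nrm_slow_inv J.+1 (c N J.+1 - c N J); have H2 := ncg N.+1.
have H3 : 2 ^+ J.+1 * nrm (c N J.+1 - c N J) <=
    2 ^+ J.+1 * (N%:R * 2 ^+ (J.+1 * N.+1) * nrm (a - g J ** a)).
  by rewrite ler_pM2l ?exprn_gt0.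
apply: (le_trans (lerD (le_trans H1 H3) H2)).
rewrite (mulnS _ N.+1) exprD -(natr1 N) mulrDl mul1r mulrDl.
rewrite !mulrA [_ * N%:R]mulrC lerD // ler_wpM2r ?nrm_ge0 //.
by rewrite -exprD ler_weXn2l ?ler1n // -mulnS leq_mul.
Qed.

Lemma nrm_slow_iter_geometric N J : (N.+3 <= J)%N ->
  nrm (c N J.+1 - c N J) <= 3 * N%:R * 2^-1 ^+ J.
Proof.
move=> NJ; apply: (le_trans (nrm_slow_iter_step N J)).
have H := nrm_a_approx J.
apply: (@le_trans _ _ (N%:R * 2 ^+ (J.+1 * N.+1) * (3 * 2^-1 ^+ (J ^ 2)))).
  by rewrite ler_wpM2l ?mulr_ge0 ?exprn_ge0.
have -> : N%:R * 2 ^+ (J.+1 * N.+1) * (3 * 2^-1 ^+ (J ^ 2)) =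
  3 * N%:R * (2 ^+ (J.+1 * N.+1) * 2^-1 ^+ (J ^ 2)) :> R by ring.
rewrite ler_wpM2l ?mulr_ge0 //.
(* The threshold on [J] lets the square absorb the growth and leave a spare [J]. *)
have /subnKC <- : (J.+1 * N.+1 + J <= J ^ 2)%N by nia.
rewrite !exprD !mulrA -exprMn mulfV // expr1n mul1r ler_piMr ?exprn_ge0 //.
by rewrite exprn_ile1 // invf_le1 // ler1n.
Qed.

(** Scale [slow_prodK] by [2^-J] and pass to the limit: [u J ** c N.+1 J] is [c N J] up to
    [2^-J c N.+1 J]. *)
Lemma slow_factor : exists (b : A) (d : nat -> A),
  d 0%N = a /\ forall N, b ** d N.+1 = d N.
Proof.
have [b Hb] := slow_limit.
have /choice[d Hd] : forall N, exists l, forall J, (N.+3 <= J)%N ->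
    nrm (l - c N J) <= 2 * (3 * N%:R) * 2^-1 ^+ J.
  move=> N; exact: nrm_geometric_cvg (@nrm_slow_iter_geometric N).
exists b, d; split.
  apply/eqP; rewrite -subr_eq0; apply/eqP.
  exact: (@nrm_geometric_eq0 _ _ (d 0%N - a) _ _ (Hd 0%N)).
move=> N; apply/eqP; rewrite -subr_eq0; apply/eqP.
pose u J := (2^-1 ^+ J)%:C *: slow_prod J.
have uE J : u J ** c N.+1 J = c N J - (2^-1 ^+ J)%:C *: c N.+1 J.
  have PLe : slow_prod J ** c N.+1 J = c N J *+ 2 ^ J - c N.+1 J.
    by rewrite -slow_prodK; zmod.
  rewrite /u cmulZl PLe scalerBr -(scaler_nat (2 ^ J)) scalerA; congr (_ - _).
  rewrite -(rmorph_nat (real_complex R)) -rmorphM natrX -exprMn mulVf ?pnatr_eq0 //.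
  by rewrite expr1n scale1r.
pose n : R := N.+1%:R.
(* The constant adds up the bounds [K1] to [K4]; the threshold is the one for [d N.+1]. *)
apply: (@nrm_geometric_eq0 _ _ _
  (5 * nrm (d N.+1) + 6 * n * nrm b + 36 * n) N.+4) => J NJ.
have -> : b ** d N.+1 - d N = (b - u J) ** d N.+1 + u J ** (d N.+1 - c N.+1 J)
   - (d N - c N J) - (2^-1 ^+ J)%:C *: c N.+1 J.
  by rewrite !(cmulBr, cmulBl) uE; zmod.
have Hd1 := Hd N.+1 J NJ; have Hd0 := Hd N J (ltnW NJ); have Hu := Hb J.
rewrite -/(u J) -/n in Hd1 Hu.
have H1 := ler_nrmM (b - u J) (d N.+1).
have H2 := ler_nrmM (u J) (d N.+1 - c N.+1 J).
have H3 : nrm (u J) <= nrm b + nrm (b - u J).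
  by rewrite nrmC; have := ler_nrmD b (u J - b); rewrite addrCA subrr addr0.
have H4 : nrm (c N.+1 J) <= nrm (d N.+1) + nrm (d N.+1 - c N.+1 J).
  rewrite nrmC; have := ler_nrmD (d N.+1) (c N.+1 J - d N.+1).
  by rewrite addrCA subrr addr0.
have H5 : nrm ((2^-1 ^+ J)%:C *: c N.+1 J) = 2^-1 ^+ J * nrm (c N.+1 J).
  by rewrite nrmZ ger0_norm // exprn_ge0.
set v1 := _ ** d N.+1 in H1 *; set v2 := u J ** _ in H2 *.
set v3 := d N - _ in Hd0 *; set v4 := _ *: _ in H5 *.
have H6 := ler_nrmB (v1 + v2 - v3) v4; have H7 := ler_nrmB (v1 + v2) v3.
have H8 := ler_nrmD v1 v2; have n1 : N%:R <= n by rewrite ler_nat.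
have n0 : 0 <= n by [].
have t0 : 0 <= 2^-1 ^+ J :> R by rewrite exprn_ge0.
have t1 : 2^-1 ^+ J <= 1 :> R by rewrite exprn_ile1 // invf_le1 // ler1n.
have b0 := nrm_ge0 b; have d0 := nrm_ge0 (d N.+1).
have x0 := nrm_ge0 (d N.+1 - c N.+1 J).
move: Hd1 Hd0 Hu H1 H2 H3 H4 H5 t0 t1.
set t := 2^-1 ^+ J; set D := nrm (d N.+1) in d0 *; set X := nrm (_ - c _ _) in x0 *.
set U := nrm (u J); set Y := nrm (b - u J); set Z := nrm (c _ _).
move=> Hd1 Hd0 Hu H1 H2 H3 H4 H5 t0 t1.
have K1 : nrm v1 <= 4 * t * D by apply: (le_trans H1); rewrite ler_wpM2r.
have K2 : nrm v2 <= (nrm b + 4) * (6 * n * t).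
  by apply: (le_trans H2); rewrite ler_pM ?nrm_ge0 //; lra.
have K3 : nrm v3 <= 6 * n * t.
  by apply: (le_trans Hd0); rewrite mulrA -natrM ler_wpM2r // ler_wpM2l.
have K4 : nrm v4 <= t * (D + 6 * n).
  rewrite H5 ler_wpM2l // (le_trans H4) // lerD2l (le_trans Hd1) //.
  by rewrite mulrA -natrM ler_piMr // mulr_ge0.
apply: (le_trans H6); lra.
Qed.

End SlowProducts.

(** * Power factorization of arbitrary elements, and prime ideals *)

Section PrimeIdeals.
Context {R : realType} {A : cstarAlgType R}.
Implicit Types (a b x y z : A) (I J K : set A).

(** Scaling [a] to norm at most [1/2] is undone in [d]; the added 1 in [s] covers [a = 0]. *)
Lemma power_factorization a : exists (b : A) (d : nat -> A),
  d 0%N = a /\ forall N, b ** d N.+1 = d N.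
Proof.
pose s : R := (2 * nrm a + 1)^-1.
have p0 : 0 < 2 * nrm a + 1 by have := nrm_ge0 a; lra.
have s0 : 0 < s by rewrite invr_gt0.
have sa2 : nrm (s%:C *: a) <= 2^-1.
  rewrite nrmZ gtr0_norm // mulrC ler_pdivrMr //; lra.
have [e he] := approximate_unit sa2.
have [b [d [d0 bd]]] : exists (b : A) (d : nat -> A),
    d 0%N = s%:C *: a /\ forall N, b ** d N.+1 = d N.
  apply: (@slow_factor _ _ _ e).
  - by move=> m n; case: (he n).
  - by move=> n; case: (he n).
  - by move=> n; case: (he n).
  - by move=> n; case: (he n).
  - by move=> n; case: (he n) => _ _ _ _ [].
  - by move=> n; case: (he n) => _ _ _ _ [].
exists b, (fun n => s^-1%:C *: d n); split.
  by rewrite d0 scalerA -rmorphM mulVf ?gt_eqF // rmorph1 scale1r.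
by move=> N; rewrite cmulZr bd.
Qed.

Lemma idealD I x y : two_sided_ideal I -> I x -> I y -> I (x + y).
Proof.
by move=> [I0 IB _ _] Ix Iy; rewrite -[y]opprK -[- y]sub0r; apply: (IB); last exact: IB.
Qed.

Lemma ideal_add I J : two_sided_ideal I -> two_sided_ideal J ->
  two_sided_ideal [set x | exists i j, [/\ I i, J j & x = i + j]].
Proof.
move=> [I0 IB Il Ir] [J0 JB Jl Jr]; split.
- by exists 0, 0; rewrite addr0.
- move=> _ _ [i [j [Ii Jj ->]]] [i' [j' [Ii' Jj' ->]]].
  by exists (i - i'), (j - j'); split; [exact: IB|exact: JB|zmod].
- move=> a _ [i [j [Ii Jj ->]]]; exists (a ** i), (a ** j).
  by split; [exact: Il|exact: Jl|exact: cmulDr].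
- move=> a _ [i [j [Ii Jj ->]]]; exists (i ** a), (j ** a).
  by split; [exact: Ir|exact: Jr|exact: cmulDl].
Qed.

Lemma ideal_gen_ideal (X : set A) : two_sided_ideal (ideal_gen X).
Proof.
split.
- by move=> K [[]].
- by move=> x y Ix Iy K XK; have [[_ KB _ _] _] := XK; apply: KB; [exact: Ix|exact: Iy].
- by move=> a x Ix K XK; have [[_ _ Kl _] _] := XK; apply: Kl; exact: Ix.
- by move=> a x Ix K XK; have [[_ _ _ Kr] _] := XK; apply: Kr; exact: Ix.
Qed.

(* Shifted since [A] has no unit: [cpow b n] is [b^(n+1)]. *)
Definition cpow b n := iter n (cmul b) b.

Lemma cpowD b m n : cpow b m ** cpow b n = cpow b (m + n).+1.
Proof. by elim: m => //= m IHm; rewrite -cmulA IHm. Qed.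

(** An ideal maximal among those containing [I] and avoiding a multiplicatively closed set is
    prime. *)
Lemma prime_avoiding_powers I b : two_sided_ideal I -> (forall n, ~ I (cpow b n)) ->
  exists M, [/\ prime_ideal M, I `<=` M & forall n, ~ M (cpow b n)].
Proof.
move=> I_ideal Ib.
(* The condition is on the union with [I] because chains may be empty: the empty union then yields
   [I] itself. *)
pose ok J := two_sided_ideal (I `|` J) /\ forall n, ~ (I `|` J) (cpow b n).
have [F Fok Ftot|M0 [[M_ideal Mb] Mmax]] := @Zorn_bigcup A ok.
  have ok_of x : (I `|` \bigcup_(J in F) J) x ->
      I x \/ exists2 J, F J & (I `|` J) x.
    by move=> [|[J FJ Jx]]; [left|right; exists J => //; right].
  have sub J : F J -> I `|` J `<=` I `|` \bigcup_(J in F) J.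
    by move=> FJ x [|Jx]; [left|right; exists J].
  split; last first.
    move=> n /ok_of[|[J FJ]]; first exact: Ib.
    by have [_] := Fok _ FJ; apply.
  have [I0 IB Il Ir] := I_ideal.
  split; first by left.
  - move=> x y /ok_of[Ix|[J FJ Jx]] /ok_of[Iy|[K FK Ky]].
    + by left; exact: IB.
    + have [[_ KB _ _] _] := Fok _ FK.
      by apply: (sub K) => //; apply: KB => //; left.
    + have [[_ JB _ _] _] := Fok _ FJ.
      by apply: (sub J) => //; apply: JB => //; left.
    + have [JK|KJ] := Ftot J K FJ FK.
      * have [[_ KB _ _] _] := Fok _ FK.
        by apply: (sub K) => //; apply: KB => //; apply: setUS Jx.
      * have [[_ JB _ _] _] := Fok _ FJ.
        by apply: (sub J) => //; apply: JB => //; apply: setUS Ky.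
  - move=> a x /ok_of[Ix|[J FJ Jx]]; first by left; exact: Il.
    by have [[_ _ Jl _] _] := Fok _ FJ; apply: (sub J) => //; exact: Jl.
  - move=> a x /ok_of[Ix|[J FJ Jx]]; first by left; exact: Ir.
    by have [[_ _ _ Jr] _] := Fok _ FJ; apply: (sub J) => //; exact: Jr.
set M := I `|` M0 in M_ideal Mb; exists M; split=> //; last by move=> x; left.
(* By maximality, [M + J] meets the powers of [b] once [J] leaves [M]. *)
have hit J : two_sided_ideal J -> ~ J `<=` M ->
    exists n m j, [/\ M m, J j & cpow b n = m + j].
  move=> J_ideal /existsNP[y /not_implyP[Jy My]].
  pose S := [set x | exists m j, [/\ M m, J j & x = m + j]].
  have S_ideal : two_sided_ideal S by exact: ideal_add.
  have MS : M `<=` S.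
    by move=> x Mx; exists x, 0; rewrite addr0; split=> //; case: J_ideal.
  have Sy : S y.
    by exists 0, y; rewrite add0r; split=> //; case: M_ideal.
  have IS : I `|` S = S by apply/setUidPr => x Ix; apply: MS; left.
  apply: contrapT => nohit; apply: (Mmax S).
    split; first by move=> x Mx; apply: MS; right.
    by move=> /(_ _ Sy) M0y; apply: My; right.
  split; rewrite IS // => n [m [j H]]; apply: nohit; exists n, m, j; exact: H.
split=> //.
  by move=> MT; apply: (Mb 0%N); rewrite -/M MT.
move=> J K J_ideal K_ideal JK.
apply: contrapT => /not_orP[/(hit _ J_ideal) HJ /(hit _ K_ideal) HK].
have [p [m [j [Mm Jj pE]]]] := HJ; have [q [m' [k [Mm' Kk qE]]]] := HK.
(* In [(m + j)(m' + k)] every term but [j ** k] has a factor in [M], and [j ** k] lies in [M] by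
   assumption. *)
apply: (Mb (p + q).+1); rewrite -cpowD pE qE cmulDl.
have [_ _ Ml Mr] := M_ideal.
apply: idealD => //; first exact: Mr.
rewrite cmulDr; apply: idealD => //; first exact: Ml.
apply: JK; exists 1%N, (fun=> j), (fun=> k); split=> //.
by rewrite big_ord1.
Qed.

End PrimeIdeals.

Theorem corollary2p5 (R : realType) (A : cstarAlgType R) (X : set A) :
  ideal_gen X = [set: A] <->
  (forall I : set A, prime_ideal I -> ~ (X `<=` I)).
Proof.
split=> [XT I [I_ideal IT _] XI|noprime].
  by apply: IT; rewrite -subTset -XT => x Xx; exact: (Xx I (conj I_ideal XI)).
rewrite -subTset => a _; apply: contrapT => Xa.
have [b [d [d0 bd]]] := power_factorization a.
(* As [a] is a multiple of every power of [b], a power of [b] in the generated ideal would put [a]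
   there. *)
have dE n : cpow b n ** d n.+1 = a.
  elim: n => [|n IHn]; first by rewrite bd.
  by have := cpowD b n 0; rewrite addn0 => <-; rewrite -cmulA bd.
have [n Xb|M [Mprime XM _]] := prime_avoiding_powers (b := b) (ideal_gen_ideal X).
  have [_ _ _ Xr] := ideal_gen_ideal X.
  by apply: Xa; rewrite -(dE n); exact: Xr.
by apply: (noprime M Mprime) => x Xx; apply: XM => K [_]; apply.
Qed.
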